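(* Assume that the set of KKT points $U^*$ is nonempty, that each $f_i$ ($i=1,\dots,n$) is strongly convex with constant $\mu_i>0$, and that the matrices $P_1,\dots,P_n$ are symmetric with $P_i \succ \frac{\rho^2}{2\mu}\|T\|_2^2\, I$ for all $i=1,\dots,n$, where $\mu=\min_{1\le i\le n}\mu_i$ and $T$ is the strictly block upper triangular part of $A^TA$. Let $\rho>0$, $\gamma\in(0,2)$, and let $x^{(0)}\in\mathbb{R}^N$, $y^{(0)}\in\mathbb{R}^m$ be arbitrary. Then the sequence $\{u^{(k)}\}_{k\ge 0}$, $u^{(k)}=(x^{(k)},y^{(k)})$, generated by the F-ADMM algorithm converges to some vector $u^L\in U^*$; that is, to a solution of the problem of minimizing $\sum_{i=1}^n f_i(x_i)$ subject to $\sum_{i=1}^n A_ix_i=b$ (together with an associated dual solution).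
   Context: Problem: let $n\ge 2$, $N=\sum_{i=1}^n N_i$, $b\in\mathbb{R}^m$, $A_i\in\mathbb{R}^{m\times N_i}$, $A=[A_1,\dots,A_n]\in\mathbb{R}^{m\times N}$, and let $f_i:\mathbb{R}^{N_i}\to\mathbb{R}\cup\{\infty\}$ be closed convex functions. Write $x=(x_1,\dots,x_n)\in\mathbb{R}^N$ with $x_i\in\mathbb{R}^{N_i}$ and $f(x)=\sum_{i=1}^n f_i(x_i)$. The problem is to minimize $f(x)$ subject to $Ax=b$. $\partial f(x)=\{s:\ \langle s,w-x\rangle\le f(w)-f(x)\ \ \forall w\in\operatorname{dom} f\}$ is the subdifferential, with $\operatorname{dom} f=\{x: f(x)<\infty\}$ (similarly for $f_i$). The function $f_i$ is strongly convex with constant $\mu_i>0$ if $f_i(w)\ge f_i(x)+\langle s,w-x\rangle+\frac{\mu_i}{2}\|w-x\|_2^2$ for all $x,w\in\operatorname{dom} f_i$ and all $s\in\partial f_i(x)$. The set of KKT (saddle) points is $U^*=\{(x^*,y^* )\in\mathbb{R}^{N+m}:\ A^Ty^*\in\partial f(x^* ),\ Ax^*=b\}$. $T\in\mathbb{R}^{N\times N}$ is the block matrix whose $(i,j)$ block is $A_i^TA_j$ if $i<j$ and $0$ otherwise; $\|T\|_2$ is its spectral norm. For symmetric positive definite $M$, $\|z\|_M^2=z^TMz$. $X\succ Y$ means $X-Y$ is positive definite. F-ADMM algorithm: given $x^{(0)},y^{(0)}$, for $k=0,1,2,\dots$ compute, successively for $i=1,\dots,n$, $$x_i^{(k+1)}=\arg\min_{x_i}\Big\{f_i(x_i)+\frac{\rho}{2}\Big\|A_ix_i+\sum_{j=1}^{i-1}A_jx_j^{(k+1)}+\sum_{l=i+1}^{n}A_lx_l^{(k)}-b-\frac{y^{(k)}}{\rho}\Big\|_2^2+\frac12\|x_i-x_i^{(k)}\|_{P_i}^2\Big\},$$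 and then $y^{(k+1)}=y^{(k)}-\gamma\rho(Ax^{(k+1)}-b)$. *)

(* Defs.v *)
From HB Require Import structures.
From mathcomp Require Import all_boot all_order all_algebra.
From mathcomp Require Import all_classical all_reals all_analysis.

Set Implicit Arguments.
Unset Strict Implicit.
Unset Printing Implicit Defensive.

Import Order.TTheory GRing.Theory Num.Theory.
Import numFieldNormedType.Exports.

Local Open Scope classical_set_scope.
Local Open Scope ring_scope.

Section Euclidean.
Variable R : realType.

Definition inner (d : nat) (u v : 'cV[R]_d) : R := (u^T *m v) 0 0.

(* The norm MathComp-Analysis puts on matrices is the sup norm, hence a
   separate Euclidean norm; both induce the canonical topology of 'cV[R]_d. *)
Definition norm2 (d : nat) (v : 'cV[R]_d) : R := Num.sqrt (inner v v).

Definition sqnormM (d : nat) (M : 'M[R]_d) (z : 'cV[R]_d) : R :=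
  (z^T *m M *m z) 0 0.

Definition posdef (d : nat) (M : 'M[R]_d) : Prop :=
  M^T = M /\ forall z : 'cV[R]_d, z != 0 -> 0 < sqnormM M z.

Definition spectral_norm (p q : nat) (M : 'M[R]_(p, q)) : R :=
  sup [set norm2 (M *m v) | v in [set v : 'cV[R]_q | norm2 v <= 1]].

Definition is_minimum (n : nat) (c : 'I_n -> R) (a : R) : Prop :=
  (exists i, a = c i) /\ forall i, a <= c i.

End Euclidean.

Section ConvexAnalysis.
Variables (R : realType) (d : nat).
Implicit Types f : 'cV[R]_d -> \bar R.
Local Open Scope ereal_scope.

Definition edom f : set 'cV[R]_d := [set x | f x < +oo].

(* Closed convex functions with values in R U {+oo}. *)
Definition closed_convex f : Prop :=
  [/\ forall x, f x != -oo,
      closed [set p : 'cV[R]_d * R | f p.1 <= p.2%:E] &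
      forall (x w : 'cV[R]_d) (t : R), (0 <= t <= 1)%R ->
        f (t *: x + (1 - t) *: w)%R <= t%:E * f x + (1 - t)%:E * f w].

(* The clause [edom f x] is automatic unless f is identically +oo, in which
   case it makes the subdifferential empty instead of the whole space. *)
Definition subdiff f (x : 'cV[R]_d) : set 'cV[R]_d :=
  [set s | edom f x /\
    forall w, edom f w -> (inner s (w - x))%:E <= f w - f x].

Definition strongly_convex f (mu : R) : Prop :=
  (0 < mu)%R /\
  forall x w s, edom f x -> edom f w -> subdiff f x s ->
    f x + (inner s (w - x))%:E + (mu / 2 * norm2 (w - x) ^+ 2)%:E <= f w.

Definition argmin f : set 'cV[R]_d := [set z | forall w, f z <= f w].

End ConvexAnalysis.

Section LinearlyConstrained.
Variables (R : realType) (d m : nat).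
Variables (f : 'cV[R]_d -> \bar R) (A : 'M[R]_(m, d)) (b : 'cV[R]_m).
Local Open Scope ereal_scope.

Definition kkt_points : set ('cV[R]_d * 'cV[R]_m) :=
  [set u | subdiff f u.1 (A^T *m u.2)%R /\ (A *m u.1)%R = b].

Definition primal_solution (x : 'cV[R]_d) : Prop :=
  [/\ (A *m x)%R = b, edom f x &
      forall w : 'cV[R]_d, (A *m w)%R = b -> f x <= f w].

(* The sign of the multiplier is the one for which stationarity of the
   Lagrangian reads A^T y \in subdiff f x. *)
Definition dual_function (y : 'cV[R]_m) : \bar R :=
  ereal_inf [set f x - (inner y (A *m x - b)%R)%:E | x in [set: 'cV[R]_d]].

Definition dual_solution (y : 'cV[R]_m) : Prop :=
  forall y', dual_function y' <= dual_function y.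

End LinearlyConstrained.

(* A point x of R^(N_1 + ... + N_n) is a column of height \sum_i N i, whose
   i-th block x_i is [submxcol x i]. *)
Section Blocks.
Variables (R : realType) (n m : nat) (N : 'I_n -> nat).

Definition separable_sum (f : forall i, 'cV[R]_(N i) -> \bar R)
    (x : 'cV[R]_(\sum_i N i)) : \bar R :=
  (\sum_(i < n) f i (submxcol x i))%E.

Definition block_row (A : forall i, 'M[R]_(m, N i)) : 'M[R]_(m, \sum_i N i) :=
  \mxrow_(i < n) A i.

Definition strict_upper_gram (A : forall i, 'M[R]_(m, N i)) :
    'M[R]_(\sum_i N i, \sum_i N i) :=
  \mxblock_(i < n, j < n) (if (i < j)%N then (A i)^T *m A j else 0).

Variables (f : forall i, 'cV[R]_(N i) -> \bar R).
Variables (A : forall i, 'M[R]_(m, N i)) (b : 'cV[R]_m).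
Variables (P : forall i, 'M[R]_(N i)) (rho gamma : R).

Definition fadmm_objective (xold xnew : 'cV[R]_(\sum_i N i)) (y : 'cV[R]_m)
    (i : 'I_n) (z : 'cV[R]_(N i)) : \bar R :=
  (f z
   + (rho / 2 * norm2 (A i *m z
        + \sum_(j < n | (j < i)%N) A j *m submxcol xnew j
        + \sum_(l < n | (i < l)%N) A l *m submxcol xold l
        - b - rho^-1 *: y) ^+ 2)%:E
   + (2^-1 * sqnormM (P i) (z - submxcol xold i))%:E)%E.

(* The i-th subproblem only reads the blocks j < i of x k.+1. *)
Definition fadmm_sequence (x : nat -> 'cV[R]_(\sum_i N i))
    (y : nat -> 'cV[R]_m) : Prop :=
  forall k : nat,
    (forall i : 'I_n, argmin (@fadmm_objective (x k) (x k.+1) (y k) i)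
                        (submxcol (x k.+1) i)) /\
    y k.+1 = y k - (gamma * rho) *: (block_row A *m x k.+1 - b).

End Blocks.

(* Main.v *)
(** Optimality of the block subproblems says that, with [r = A x' - b] and
    [d = x' - x], the vector [A^T (y - rho r) + rho T d - P d] is a subgradient
    of the separable objective at the new iterate [x'].  Strong monotonicity
    against a KKT point, with [rho <T d, e>] absorbed by Young's inequality into
    [mu |e|^2 + rho^2 |T|^2 |d|^2 / (4 mu)], makes the Lyapunov function
    [|x - x*|_P^2 / 2 + |y - y*|^2 / (2 gamma rho)] decrease by at least
    [rho (1 - gamma/2) |r|^2 + |d|_Q^2 / 2], where
    [Q = P - rho^2 |T|^2 / (2 mu) I] is positive definite.  Hence [r] and [d]
    vanish in the limit and the iterates are bounded, so they converge along an
    ultrafilter on the indices to a point which is KKT because the graph of the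
    subdifferential is closed.  The Lyapunov function at that point is
    nonincreasing and tends to 0 along the ultrafilter, hence tends to 0. *)

Require Import Defs.
From HB Require Import structures.
From mathcomp Require Import all_boot all_order all_algebra.
From mathcomp Require Import all_classical all_reals all_analysis.
From mathcomp Require Import ring lra.

Import Order.TTheory GRing.Theory Num.Theory.
Import numFieldNormedType.Exports.

Local Open Scope classical_set_scope.
Local Open Scope ring_scope.

Set Implicit Arguments.
Unset Strict Implicit.
Unset Printing Implicit Defensive.

(** * Euclidean and weighted inner products, Cauchy-Schwarz, and the spectral norm bound *)

Section InnerProduct.
Context {R : realType}.

Lemma innerE (d : nat) (u v : 'cV[R]_d) :
  inner u v = \sum_i u i 0 * v i 0.
Proof. by rewrite /inner mxE; apply: eq_bigr => i _; rewrite mxE. Qed.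

Lemma innerC (d : nat) (u v : 'cV[R]_d) : inner u v = inner v u.
Proof. by rewrite !innerE; apply: eq_bigr => i _; rewrite mulrC. Qed.

Lemma innerDl (d : nat) (u v w : 'cV[R]_d) :
  inner (u + v) w = inner u w + inner v w.
Proof. by rewrite /inner linearD mulmxDl mxE. Qed.

Lemma innerDr (d : nat) (u v w : 'cV[R]_d) :
  inner w (u + v) = inner w u + inner w v.
Proof. by rewrite /inner mulmxDr mxE. Qed.

Lemma innerNl (d : nat) (u w : 'cV[R]_d) : inner (- u) w = - inner u w.
Proof. by rewrite /inner linearN mulNmx mxE. Qed.

Lemma innerNr (d : nat) (u w : 'cV[R]_d) : inner w (- u) = - inner w u.
Proof. by rewrite /inner mulmxN mxE. Qed.

Lemma innerZl (d : nat) a (u w : 'cV[R]_d) : inner (a *: u) w = a * inner u w.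
Proof. by rewrite /inner linearZ -scalemxAl mxE. Qed.

Lemma innerZr (d : nat) a (u w : 'cV[R]_d) : inner w (a *: u) = a * inner w u.
Proof. by rewrite /inner -scalemxAr mxE. Qed.

Definition innerDZ :=
  (@innerDl, @innerDr, @innerNl, @innerNr, @innerZl, @innerZr).

Lemma inner_mulmxl (p q : nat) (M : 'M[R]_(p, q)) (u : 'cV_q) (v : 'cV_p) :
  inner (M *m u) v = inner u (M^T *m v).
Proof. by rewrite /inner trmx_mul mulmxA. Qed.

Lemma inner_ge0 (d : nat) (v : 'cV[R]_d) : 0 <= inner v v.
Proof. by rewrite innerE sumr_ge0 // => i _; rewrite -expr2 sqr_ge0. Qed.

Lemma inner_eq0 (d : nat) (v : 'cV[R]_d) : inner v v = 0 -> v = 0.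
Proof.
rewrite innerE => /eqP; rewrite psumr_eq0; last first.
  by move=> i _; rewrite -expr2 sqr_ge0.
move=> /allP v0; apply/colP => i; rewrite mxE.
by have := v0 i (mem_index_enum i); rewrite mulf_eq0 orbb => /eqP.
Qed.

Lemma sqr_norm2 (d : nat) (v : 'cV[R]_d) : norm2 v ^+ 2 = inner v v.
Proof. by rewrite sqr_sqrtr ?inner_ge0. Qed.

Lemma norm2_ge0 (d : nat) (v : 'cV[R]_d) : 0 <= norm2 v.
Proof. exact: sqrtr_ge0. Qed.

Lemma sqnormME (d : nat) (M : 'M[R]_d) z : sqnormM M z = inner z (M *m z).
Proof. by rewrite /sqnormM /inner mulmxA. Qed.

Lemma sqnormM_ge0 (d : nat) (M : 'M[R]_d) z : posdef M -> 0 <= sqnormM M z.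
Proof.
move=> [_ M_gt0]; have [->|/M_gt0/ltW//] := eqVneq z 0.
by rewrite /sqnormM mulmx0 mxE.
Qed.

Lemma inner_sym (d : nat) (M : 'M[R]_d) (u v : 'cV_d) :
  M^T = M -> inner u (M *m v) = inner v (M *m u).
Proof. by move=> Msym; rewrite innerC inner_mulmxl Msym. Qed.

(** Subtracting from [v] its [M]-orthogonal projection onto [u] leaves a vector of nonnegative
    squared [M]-norm; multiplying by [sqnormM M u] clears the denominator. *)
Lemma posdef_CauchySchwarz (d : nat) (M : 'M[R]_d) (u v : 'cV_d) : posdef M ->
  inner u (M *m v) ^+ 2 <= sqnormM M u * sqnormM M v.
Proof.
move=> pM; have [Msym M_gt0] := pM.
have [->|/M_gt0] := eqVneq u 0.
  by rewrite /inner trmx0 mul0mx mxE expr2 mul0r mulr_ge0 ?sqnormM_ge0.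
set q := sqnormM M u => q_gt0.
have := sqnormM_ge0 (v - (inner u (M *m v) / q) *: u) pM.
rewrite sqnormME mulmxBr -scalemxAr !innerDZ -!sqnormME -/q (inner_sym v u Msym).
set B := inner _ _; set Q := sqnormM M v => h.
have {h} : 0 <= q * (Q - B / q * B - B / q * (B - B / q * q)).
  by apply: mulr_ge0; [exact: ltW | lra].
have -> : q * (Q - B / q * B - B / q * (B - B / q * q)) = q * Q - B ^+ 2.
  by field; rewrite gt_eqF.
by rewrite subr_ge0.
Qed.

Lemma posdef_1 (d : nat) : posdef (1%:M : 'M[R]_d).
Proof.
split=> [|z z0]; first by rewrite trmx1.
rewrite sqnormME mul1mx lt_neqAle inner_ge0 andbT eq_sym.
by apply: contraNneq z0 => /inner_eq0 ->.
Qed.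

Lemma CauchySchwarz (d : nat) (u v : 'cV[R]_d) :
  inner u v ^+ 2 <= inner u u * inner v v.
Proof.
by have := posdef_CauchySchwarz u v (posdef_1 d); rewrite !sqnormME !mul1mx.
Qed.

Lemma posdef_unitmx (d : nat) (M : 'M[R]_d) : posdef M -> M \in unitmx.
Proof.
move=> [Msym M_gt0]; rewrite -row_free_unit; apply: inj_row_free => v vM0.
apply/eqP; apply/negPn/negP => v0.
have : v^T != 0 by rewrite trmx_eq0.
by move=> /M_gt0; rewrite /sqnormM trmxK vM0 mul0mx mxE ltxx.
Qed.

(* z_i = <M^-1 e_i, z>_M *)
Lemma posdef_coord_le (d : nat) (M : 'M[R]_d) (i : 'I_d) : posdef M ->
  exists2 C, 0 <= C & forall z : 'cV_d, z i 0 ^+ 2 <= C * sqnormM M z.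
Proof.
move=> pM; have [Msym _] := pM; pose w : 'cV_d := invmx M *m delta_mx i 0.
exists (sqnormM M w) => [|z]; first exact: sqnormM_ge0.
suff -> : z i 0 = inner w (M *m z) by exact: posdef_CauchySchwarz.
rewrite inner_sym// mulmxA mulmxV ?posdef_unitmx// mul1mx innerE (bigD1 i)//=.
rewrite mxE !eqxx mulr1 big1 ?addr0// => j /negPf ji.
by rewrite mxE ji mulr0.
Qed.

Lemma posdefD_scalar (d : nat) (M : 'M[R]_d) c :
  posdef (M - c%:M) -> 0 <= c -> posdef M.
Proof.
move=> [+ M_gt0] c0; rewrite linearB /= tr_scalar_mx => /addIr Msym.
split=> // z /M_gt0; rewrite !sqnormME mulmxBl mul_scalar_mx innerDr innerNr innerZr.
by rewrite subr_gt0; apply: le_lt_trans; rewrite mulr_ge0 ?inner_ge0.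
Qed.

Lemma norm2_le (d : nat) (v : 'cV[R]_d) a : inner v v <= a -> norm2 v <= Num.sqrt a.
Proof. by move=> va; rewrite ler_sqrt// (le_trans _ va)// inner_ge0. Qed.

(** Cauchy-Schwarz on each row; the constant is the squared Frobenius norm. This makes the supremum
    defining [spectral_norm] one of a bounded set. *)
Lemma mulmx_bounded (p q : nat) (M : 'M[R]_(p, q)) :
  exists2 K, 0 <= K & forall v, inner (M *m v) (M *m v) <= K * inner v v.
Proof.
exists (\sum_i inner (row i M)^T (row i M)^T) => [|v].
  by apply: sumr_ge0 => i _; exact: inner_ge0.
rewrite innerE mulr_suml; apply: ler_sum => i _.
have -> : (M *m v) i 0 = inner (row i M)^T v.
  by rewrite innerE mxE; apply: eq_bigr => j _; rewrite !mxE.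
by rewrite -expr2 CauchySchwarz.
Qed.

Lemma inner_spectral_norm (p q : nat) (M : 'M[R]_(p, q)) v :
  inner (M *m v) (M *m v) <= spectral_norm M ^+ 2 * inner v v.
Proof.
have [K K0 HK] := mulmx_bounded M.
have le_sup w : norm2 w <= 1 -> norm2 (M *m w) <= spectral_norm M.
  move=> w1; apply: ub_le_sup; last by exists w.
  exists (Num.sqrt K) => _ [u u1 <-]; apply: norm2_le; apply: le_trans (HK u) _.
  by rewrite ler_piMr// -sqr_norm2 expr_le1// sqrtr_ge0.
(* The supremum ranges over the unit ball, so a nonzero [v] is normalized first and the bound is
   then scaled back. *)
have [/inner_eq0 ->|v0] := eqVneq (inner v v) 0.
  by rewrite mulmx0 /inner !mulmx0 !mxE mulr0.
have v_gt0 : 0 < norm2 v by rewrite sqrtr_gt0 lt_neqAle eq_sym v0 inner_ge0.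
have h : inner ((norm2 v)^-1 *: v) ((norm2 v)^-1 *: v) = 1.
  by rewrite !innerDZ -sqr_norm2; field; rewrite gt_eqF.
have /le_sup : norm2 ((norm2 v)^-1 *: v) <= 1 by rewrite /norm2 h sqrtr1.
move=> Mv_le; have s_ge0 := le_trans (norm2_ge0 _) Mv_le.
move: Mv_le; rewrite -(@ler_pXn2r _ 2)// ?nnegrE ?norm2_ge0//.
rewrite sqr_norm2 -scalemxAr !innerDZ -[inner v v]sqr_norm2 => h2.
rewrite -ler_pdivrMr ?exprn_gt0//; apply: le_trans h2.
by rewrite le_eqVlt; apply/orP; left; apply/eqP; field; rewrite gt_eqF.
Qed.

End InnerProduct.

(** * Entrywise convergence of matrices along a filter *)

Section MatrixConvergence.
Context {R : realType} {T : Type} {F : set_system T} {FF : ProperFilter F}.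

Lemma cvg_mxP (p q : nat) (u : T -> 'M[R]_(p, q)) (l : 'M[R]_(p, q)) :
  u @ F --> l <-> forall i j, (fun k => u k i j) @ F --> l i j.
Proof.
split=> [ul i j|ul]; first exact: (cvg_comp _ _ ul (@coord_continuous _ _ _ i j l)).
move=> B [P lP PB]; apply: (@filterS _ F FF _ _ (fun x => PB (u x))) => /=.
apply: filter_forall => i; apply: filter_forall => j.
exact: (ul i j).
Qed.

Lemma cvg_sumr (I : Type) (r : seq I) (u : I -> T -> R) (l : I -> R) :
  (forall i, u i @ F --> l i) ->
  (fun k => \sum_(i <- r) u i k) @ F --> \sum_(i <- r) l i.
Proof. by move=> ul; apply: cvg_big => //; exact: add_continuous. Qed.

Lemma cvg_mulrl (c : R) (u : T -> R) (l : R) :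
  u @ F --> l -> (fun k => c * u k) @ F --> c * l.
Proof. by move=> ul; apply: cvgM => //; exact: cvg_cst. Qed.

Lemma cvg_inner (d : nat) (u v : T -> 'cV[R]_d) (lu lv : 'cV[R]_d) :
  u @ F --> lu -> v @ F --> lv ->
  (fun k => inner (u k) (v k)) @ F --> inner lu lv.
Proof.
move=> /cvg_mxP ulu /cvg_mxP vlv; rewrite innerE.
under eq_fun do rewrite innerE.
by apply: cvg_sumr => i; exact: cvgM.
Qed.

Lemma cvg_mulmx (p q : nat) (M : 'M[R]_(p, q)) (u : T -> 'cV[R]_q) l :
  u @ F --> l -> (fun k => M *m u k) @ F --> M *m l.
Proof.
move=> /cvg_mxP ul; apply/cvg_mxP => i j; rewrite mxE.
under eq_fun do rewrite mxE.
by apply: cvg_sumr => k; exact: cvg_mulrl.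
Qed.

(** Each coordinate is squeezed by a constant multiple of the [M]-norm, which links the quadratic
    form to the canonical topology. *)
Lemma cvg_sqnormM0 (d : nat) (M : 'M[R]_d) (u : T -> 'cV[R]_d) : posdef M ->
  (fun k => sqnormM M (u k)) @ F --> (0 : R) -> u @ F --> (0 : 'cV_d).
Proof.
move=> pM u0; apply/cvg_mxP => i j; rewrite mxE ord1.
have [C C0 HC] := posdef_coord_le i pM.
have Cu0 : (fun k => Num.sqrt (C * sqnormM M (u k))) @ F --> (0 : R).
  have h : (fun k => C * sqnormM M (u k)) @ F --> (0 : R).
    by rewrite -[X in _ --> X](mulr0 C); exact: cvg_mulrl.
  have /= := cvg_comp _ _ h (@sqrt_continuous R 0).
  by rewrite sqrtr0.
apply: norm_cvg0; apply: (squeeze_cvgr _ (cvg_cst 0) Cu0).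
apply: nearW => k; rewrite normr_ge0 /= -sqrtr_sqr ler_sqrt ?HC//.
by rewrite mulr_ge0 ?sqnormM_ge0.
Qed.

End MatrixConvergence.

(** * Compactness: bounded families converge along ultrafilters *)

Section UltraCompactness.
Context {R : realType} {T : Type} {U : set_system T} {UU : UltraFilter U}.

Lemma ultra_fmap (S : Type) (g : T -> S) : UltraFilter (g @ U).
Proof.
have UF : ProperFilter U by exact: ultra_proper.
split; [exact: fmap_proper_filter|move=> G GF sUG].
apply/seteqP; split=> // B GB; rewrite /= /fmap /=.
have [//|nB] := @in_ultra_setVsetC _ U (g @^-1` B) UU.
have GnB : G (~` B) by exact: sUG.
by have /filter_ex [? []] : G (B `&` ~` B) by exact: filterI.
Qed.

Lemma ultra_bounded_cvg (u : T -> R) (C : R) :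
  (forall k, `|u k| <= C) -> exists l : R, u @ U --> l.
Proof.
move=> uC; have := @segment_compact R (- C) C; rewrite compact_ultra.
move=> /(_ (u @ U) (ultra_fmap u)) [|l [_ ul]]; last by exists l.
have UF : ProperFilter U by exact: ultra_proper.
by apply: (@filterS _ U _ setT _ _ filterT) => k _; rewrite /= in_itv /= -ler_norml.
Qed.

Lemma ultra_bounded_cvg_mx (d : nat) (M : 'M[R]_d) (u : T -> 'cV[R]_d) C :
  posdef M -> (forall k, sqnormM M (u k) <= C) -> exists l : 'cV[R]_d, u @ U --> l.
Proof.
move=> pM uC.
have UF : ProperFilter U by exact: ultra_proper.
have /choice [l ul] i : exists l : R, (fun k => u k i 0) @ U --> l.
  have [K K0 HK] := posdef_coord_le i pM.
  apply: (@ultra_bounded_cvg _ (Num.sqrt (K * C))) => k.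
  have le_KC : u k i 0 ^+ 2 <= K * C.
    by apply: le_trans (HK _) _; rewrite ler_wpM2l.
  by rewrite -sqrtr_sqr ler_sqrt// (le_trans _ le_KC)// sqr_ge0.
by exists (\col_i l i); apply/cvg_mxP => i j; rewrite mxE ord1.
Qed.

End UltraCompactness.

(** * Subdifferentials: monotonicity, optimality conditions, closed graph *)

Section Subdifferential.
Context {R : realType} {d : nat}.
Implicit Types (f : 'cV[R]_d -> \bar R) (x w s : 'cV[R]_d).

Lemma edomP f x : f x != -oo%E -> edom f x -> exists a : R, f x = a%:E.
Proof. by rewrite /edom /=; case: (f x) => // a _ _; exists a. Qed.

Lemma subdiff_fin f x s w (a c : R) : subdiff f x s ->
  f x = a%:E -> f w = c%:E -> inner s (w - x) <= c - a.
Proof.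
move=> [_ /(_ w)] + fxE fwE; rewrite /edom /= fxE fwE lee_fin.
by apply; exact: ltry.
Qed.

(** Sum of the two strong convexity inequalities, at [x] tested with [w] and at [w] tested with [x];
    the two halves of [mu] add up. *)
Lemma strongly_convex_monotone f mu x w s t :
  (forall z, f z != -oo%E) -> strongly_convex f mu ->
  subdiff f x s -> subdiff f w t ->
  mu * inner (x - w) (x - w) <= inner (s - t) (x - w).
Proof.
move=> fNy [_ sc] xs wt; have [fx _] := xs; have [fw _] := wt.
have := sc _ _ _ fx fw xs; have := sc _ _ _ fw fx wt.
have [a ->] := edomP (fNy x) fx; have [c ->] := edomP (fNy w) fw.
rewrite -!EFinD !lee_fin !sqr_norm2 -(opprB x w) !innerDZ.
lra.
Qed.

(* Test optimality of [z] on the segments [z, w]; the first-order terms survive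
   after division by the step length. *)
Lemma subdiff_argmin f (q : 'cV[R]_d -> R) g z (C : 'cV[R]_d -> R) :
  closed_convex f -> (exists w, edom f w) ->
  (forall w (t : R), q (z + t *: (w - z)) =
     q z + t * inner g (w - z) + t ^+ 2 * C w) ->
  argmin (fun w => f w + (q w)%:E)%E z -> subdiff f z (- g).
Proof.
move=> [fNy _ fcvx] [w0 fw0] qE zmin.
(* The objective is finite at [w0], hence also at its minimizer. *)
have fz : edom f z.
  have [c0 fw0E] := edomP (fNy w0) fw0; have := zmin w0.
  rewrite fw0E /edom /=; case: (f z) (fNy z) => //= a _ _; exact: ltry.
split=> // w fw.
have [a fzE] := edomP (fNy z) fz; have [c fwE] := edomP (fNy w) fw.
rewrite fzE fwE innerNl lee_fin -subr_ge0 opprK.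
set D := (X in 0 <= X).
have step t : 0 < t -> t <= 1 -> 0 <= D + t * C w.
  move=> t0 t1; have t01 : 0 <= t <= 1 by rewrite ltW.
  have := zmin (t *: w + (1 - t) *: z).
  have := fcvx w z t t01; rewrite fzE fwE -!EFinM -EFinD.
  have -> : t *: w + (1 - t) *: z = z + t *: (w - z).
    by rewrite scalerBl scale1r scalerBr addrCA.
  rewrite qE; case: (f _) (fNy (z + t *: (w - z))) => // v _.
  rewrite -!EFinD !lee_fin => h1 h2.
  rewrite -(pmulr_rge0 _ t0) /D; lra.
rewrite leNgt; apply/negP => D0.
have n0 : 0 < - D + `|C w| by rewrite ltr_wpDr// oppr_gt0.
(* If [D < 0], this step length lies in [(0, 1]] and is short enough that [t * C w] cannot
   compensate [D]. *)
have := step (- D / (- D + `|C w|)); rewrite divr_gt0// ?oppr_gt0//.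
rewrite ler_pdivrMr// mul1r lerDl normr_ge0 => /(_ isT isT).
apply/negP; rewrite -ltNge -(pmulr_llt0 _ n0).
have -> : (D + - D / (- D + `|C w|) * C w) * (- D + `|C w|) =
   D * (- D + (`|C w| - C w)) by field; rewrite gt_eqF.
by rewrite nmulr_rlt0// ltr_wpDr ?oppr_gt0// subr_ge0 ler_norm.
Qed.

(** For fixed [w], the subgradient inequality at [u k] places the pair [p k] in the epigraph of [f];
    the epigraph is closed, so the inequality passes to the limit. *)
Lemma subdiff_closed (T : Type) (F : set_system T) (FF : ProperFilter F)
    f (u v : T -> 'cV[R]_d) x s :
  closed_convex f -> (forall k, subdiff f (u k) (v k)) ->
  u @ F --> x -> v @ F --> s -> subdiff f x s.
Proof.
move=> [fNy fclosed _] uv ux vs.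
have main w (c : R) : f w = c%:E -> (f x <= (c - inner s (w - x))%:E)%E.
  move=> fwE; pose p k := (u k, c - inner (v k) (w - u k)).
  have near_p : \forall k \near F, (f (p k).1 <= (p k).2%:E)%E.
    apply: nearW => k /=; have [fu _] := uv k.
    have [a fuE] := edomP (fNy _) fu; rewrite fuE lee_fin.
    by have := subdiff_fin (uv k) fuE fwE; lra.
  apply: (closed_cvg _ fclosed near_p (x, c - inner s (w - x))).
  have wu : (fun k => w - u k) @ F --> w - x.
    by apply: cvgB => //; exact: cvg_cst.
  have pc : (fun k => c - inner (v k) (w - u k)) @ F --> c - inner s (w - x).
    by apply: cvgB; [exact: cvg_cst | exact: cvg_inner].
  exact: (cvg_pair ux pc).
(* Finiteness of [f x] comes from testing [main] at a single [u k], where [f] is finite; properness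
   of the filter supplies such an index. *)
have [k _] := filter_ex (@filterT _ F FF).
have [fu _] := uv k; have [a fuE] := edomP (fNy _) fu.
have fx : edom f x by apply: le_lt_trans (main _ _ fuE) _; exact: ltry.
split=> // w fw; have [c fwE] := edomP (fNy _) fw; have := main w c fwE.
by have [b ->] := edomP (fNy _) fx; rewrite fwE !lee_fin; lra.
Qed.

End Subdifferential.

(** * Separable sums: domain, subdifferential and monotonicity block by block *)

Section Separable.
Context {R : realType} {n : nat} {N : 'I_n -> nat}.
Implicit Types (u v x w s : 'cV[R]_(\sum_i N i)).

Lemma inner_submxcol u v :
  inner u v = \sum_i inner (submxcol u i) (submxcol v i).
Proof.
rewrite -{1}(submxcolK u) -{1}(submxcolK v) /inner tr_mxcol mul_mxrow_mxcol.
by rewrite summxE.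
Qed.

Lemma cvg_submxcol (T : Type) (F : set_system T) (FF : ProperFilter F)
    (z : T -> 'cV[R]_(\sum_i N i)) (l : 'cV[R]_(\sum_i N i)) i :
  z @ F --> l -> (fun k => submxcol (z k) i) @ F --> submxcol l i.
Proof.
move=> /cvg_mxP zl; apply/cvg_mxP => j j0; rewrite mxE.
by under eq_fun do rewrite mxE; exact: zl.
Qed.

Context (f : forall i, 'cV[R]_(N i) -> \bar R).
Arguments f : clear implicits.
Hypothesis fNy : forall i z, f i z != -oo%E.

Lemma separable_sum_fin x (a : 'I_n -> R) :
  (forall i, f i (submxcol x i) = (a i)%:E) ->
  separable_sum f x = (\sum_i a i)%:E.
Proof. by move=> fa; rewrite -sumEFin; apply: eq_bigr. Qed.

Lemma edom_separable x :
  edom (separable_sum f) x <-> forall i, edom (f i) (submxcol x i).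
Proof.
split=> [fx i|fx]; last by apply: lte_sum_pinfty => i _; exact: fx.
rewrite /edom /= ltey; apply/eqP => fxi; move: fx; rewrite /edom /=.
have -> : separable_sum f x = +oo%E.
  apply/(@esum_eqyP _ _ _ xpredT) => [j _|]; first exact: fNy.
  by exists i; split; rewrite ?mem_index_enum.
by rewrite ltxx.
Qed.

Lemma separable_sumNy x : separable_sum f x != -oo%E.
Proof.
apply/eqP => /(esum_eqNyP _ _ _).1 [i [_ _ fxi]].
by have := fNy (submxcol x i); rewrite fxi.
Qed.

Lemma subdiff_separable x s :
  subdiff (separable_sum f) x s <->
  forall i, subdiff (f i) (submxcol x i) (submxcol s i).
Proof.
split=> [xs i|xs]; last first.
  have fx i : edom (f i) (submxcol x i) by have [] := xs i.
  split=> [|w /edom_separable fw]; first exact/edom_separable.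
  have /choice [a aE] i := edomP (fNy (submxcol x i)) (fx i).
  have /choice [c cE] i := edomP (fNy (submxcol w i)) (fw i).
  rewrite (separable_sum_fin aE) (separable_sum_fin cE) lee_fin inner_submxcol.
  rewrite -sumrB; apply: ler_sum => i _; rewrite submxcolB.
  exact: (subdiff_fin (xs i)).
have [/edom_separable fx _] := xs; split=> // w fw.
have /choice [a aE] j := edomP (fNy (submxcol x j)) (fx j).
have [c cE] := edomP (fNy w) fw.
(* Test point equal to [x] except that block [i] is [w]; all other blocks cancel in the inequality
   for the sum. *)
pose z := \mxcol_j dfwith (fun j => submxcol x j) i w j.
have zi : submxcol z i = w by rewrite mxcolK dfwithin.
have zj j : j != i -> submxcol z j = submxcol x j.
  by move=> ji; rewrite mxcolK dfwithout// eq_sym.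
have zE j : f j (submxcol z j) = (if j == i then c else a j)%:E.
  by have [->|/zj ->] := eqVneq j i; rewrite ?zi ?cE.
have := subdiff_fin xs (separable_sum_fin aE) (separable_sum_fin zE).
rewrite aE cE lee_fin inner_submxcol (bigD1 i)//= submxcolB zi.
rewrite big1 ?addr0 => [|j ji]; last first.
  by rewrite submxcolB zj// subrr /inner mulmx0 mxE.
move=> /le_trans; apply; rewrite -sumrB (bigD1 i)//= eqxx big1 ?addr0// => j /negPf ->.
by rewrite subrr.
Qed.

Lemma separable_monotone (mu_ : 'I_n -> R) mu x w s v :
  (forall i, mu <= mu_ i) -> (forall i, strongly_convex (f i) (mu_ i)) ->
  subdiff (separable_sum f) x s -> subdiff (separable_sum f) w v ->
  mu * inner (x - w) (x - w) <= inner (s - v) (x - w).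
Proof.
move=> mu_min sc /subdiff_separable xs /subdiff_separable wv.
rewrite !inner_submxcol mulr_sumr; apply: ler_sum => i _.
rewrite !submxcolB.
apply: le_trans (strongly_convex_monotone (@fNy i) (sc i) (xs i) (wv i)).
by rewrite ler_wpM2r ?inner_ge0.
Qed.

End Separable.

(** * Closed graph for separable sums and positive definite block-diagonal matrices *)

Section SeparableClosed.
Context {R : realType} {n : nat} {N : 'I_n -> nat}.

Lemma separable_subdiff_closed (T : Type) (F : set_system T)
    (FF : ProperFilter F) (f : forall i : 'I_n, 'cV[R]_(N i) -> \bar R)
    (u v : T -> 'cV[R]_(\sum_i N i)) (x s : 'cV[R]_(\sum_i N i)) :
  (forall i, closed_convex (f i)) ->
  (forall k, subdiff (separable_sum f) (u k) (v k)) ->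
  u @ F --> x -> v @ F --> s -> subdiff (separable_sum f) x s.
Proof.
move=> fcc uv ux vs; have fNy i z : f i z != -oo%E by have [] := fcc i.
apply/(subdiff_separable fNy) => i.
apply: (subdiff_closed FF (u := fun k => submxcol (u k) i)
  (v := fun k => submxcol (v k) i) (fcc i)).
- by move=> k; have /(subdiff_separable fNy) := uv k; exact.
- exact: cvg_submxcol.
- exact: cvg_submxcol.
Qed.

Lemma posdef_mxdiag (P : forall i, 'M[R]_(N i)) (c : R) :
  (forall i, posdef (P i - c%:M)) -> posdef (\mxdiag_i P i - c%:M).
Proof.
move=> hP; rewrite -mxdiagZ -mxdiagB; split.
  rewrite tr_mxdiag; apply: eq_mxdiag => i.
  by have [] := hP i.
move=> z z0; have sqE : sqnormM (\mxdiag_i (P i - c%:M)) z =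
    \sum_i sqnormM (P i - c%:M) (submxcol z i).
  rewrite sqnormME -{2}(submxcolK z) mul_mxdiag_mxcol inner_submxcol.
  by apply: eq_bigr => i _; rewrite mxcolK sqnormME.
(* A vanishing sum of nonnegative block terms would force every block of [z] to vanish. *)
rewrite sqE lt_neqAle sumr_ge0 ?andbT => [|i _]; last exact: sqnormM_ge0.
apply: contraNneq z0 => /esym/eqP; rewrite psumr_eq0 => [/allP s0|i _]; last first.
  exact: sqnormM_ge0.
apply/eqP; rewrite -(submxcolK z); apply/mxcolP => i; rewrite mxcolK submxcol0.
apply/eqP/negPn/negP => zi0; have [_ /(_ _ zi0)] := hP i.
by rewrite (eqP (s0 i (mem_index_enum i))) ltxx.
Qed.

End SeparableClosed.

(** * Optimality conditions of the F-ADMM subproblems *)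

Section FadmmOptimality.
Context {R : realType}.

Lemma subdiff_prox (d m : nat) (f : 'cV[R]_d -> \bar R) (A : 'M[R]_(m, d))
    (v : 'cV[R]_m) (P : 'M[R]_d) (x0 z : 'cV[R]_d) (rho : R) :
  closed_convex f -> (exists w, edom f w) -> P^T = P ->
  argmin (fun w => f w + (rho / 2 * norm2 (A *m w + v) ^+ 2)%:E
                       + (2^-1 * sqnormM P (w - x0))%:E)%E z ->
  subdiff f z (- (rho *: (A^T *m (A *m z + v)) + P *m (z - x0))).
Proof.
move=> fcc fdom Psym zmin.
pose q w := rho / 2 * norm2 (A *m w + v) ^+ 2 + 2^-1 * sqnormM P (w - x0).
(* [C w] is the second-order coefficient of the quadratic [q] along [w - z]; symmetry of [P] merges
   the two cross terms into the gradient. *)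
pose C w := rho / 2 * inner (A *m (w - z)) (A *m (w - z))
  + 2^-1 * sqnormM P (w - z).
apply: (subdiff_argmin (q := q) (C := C)) => // [w t|w]; last first.
  by have := zmin w; rewrite /q !EFinD !addeA.
rewrite /q /C !sqr_norm2 !sqnormME (mulmxDr A z) -scalemxAr.
have -> : A *m z + t *: (A *m (w - z)) + v = A *m z + v + t *: (A *m (w - z)).
  by rewrite addrAC.
have -> : z + t *: (w - z) - x0 = z - x0 + t *: (w - z) by rewrite addrAC.
move: (w - z) (z - x0) (A *m z + v) => D E F.
rewrite (mulmxDr P E) -scalemxAr !innerDZ (inner_mulmxl A^T F D) trmxK.
rewrite (innerC (A *m D) F) (inner_sym D E Psym) (innerC (P *m E) D).
rewrite (inner_sym D E Psym).
by field.
Qed.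

Context (n m : nat) (N : 'I_n -> nat).
Context (A : forall i, 'M[R]_(m, N i)).

Lemma submxcolZ a (x : 'cV[R]_(\sum_i N i)) i :
  submxcol (a *: x) i = a *: submxcol x i.
Proof. by apply/colP => j; rewrite !mxE. Qed.

Lemma block_row_mulmx (x : 'cV[R]_(\sum_i N i)) :
  block_row A *m x = \sum_i A i *m submxcol x i.
Proof. by rewrite -{1}(submxcolK x) mul_mxrow_mxcol. Qed.

Lemma submxcol_tr_block_row (y : 'cV[R]_m) i :
  submxcol ((block_row A)^T *m y) i = (A i)^T *m y.
Proof. by rewrite /block_row tr_mxrow -submxcol_mul mxcolK. Qed.

Lemma submxcol_strict_upper_gram (x : 'cV[R]_(\sum_i N i)) i :
  submxcol (strict_upper_gram A *m x) i =
  (A i)^T *m \sum_(l < n | (i < l)%N) A l *m submxcol x l.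
Proof.
rewrite -{1}(submxcolK x) mul_mxblock_mxrow mxcolK mulmx_sumr [RHS]big_mkcond.
by apply: eq_bigr => l _; case: ifP => _; rewrite ?mul0mx// mulmxA.
Qed.

(** Subproblem [i] sees old blocks only for [l > i]. Replacing them by new ones completes the
    residual [A x' - b], and the discrepancy is exactly block [i] of [rho T (x' - x)]. *)
Lemma fadmm_subdiff (f : forall i, 'cV[R]_(N i) -> \bar R) (b : 'cV[R]_m)
    (P : forall i, 'M[R]_(N i)) (rho gamma : R) x y k :
  (forall i, closed_convex (f i)) -> (forall i, exists w, edom (f i) w) ->
  (forall i, (P i)^T = P i) -> rho != 0 ->
  fadmm_sequence f A b P rho gamma x y ->
  subdiff (separable_sum f) (x k.+1)
    ((block_row A)^T *m (y k - rho *: (block_row A *m x k.+1 - b))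
     + rho *: (strict_upper_gram A *m (x k.+1 - x k))
     - \mxdiag_i P i *m (x k.+1 - x k)).
Proof.
move=> fcc fdom Psym rho0 /(_ k) [xmin _].
have fNy i z : f i z != -oo%E by have [] := fcc i.
apply/(subdiff_separable fNy) => i.
set S1 := \sum_(j < n | (j < i)%N) A j *m submxcol (x k.+1) j.
set S2 := \sum_(l < n | (i < l)%N) A l *m submxcol (x k) l.
pose v := S1 + S2 - b - rho^-1 *: y k.
have vE w : A i *m w + v = A i *m w + S1 + S2 - b - rho^-1 *: y k.
  by rewrite /v !addrA.
rewrite [X in subdiff _ _ X](_ : _ =
    - (rho *: ((A i)^T *m (A i *m submxcol (x k.+1) i + v))
       + P i *m (submxcol (x k.+1) i - submxcol (x k) i))).
  by apply: (subdiff_prox (v := v)) => // w; rewrite !vE; exact: xmin.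
rewrite vE !submxcolB submxcolD submxcol_tr_block_row.
have -> : submxcol (\mxdiag_i P i *m (x k.+1 - x k)) i
    = P i *m (submxcol (x k.+1) i - submxcol (x k) i).
  by rewrite -{1}(submxcolK (x k.+1 - x k)) mul_mxdiag_mxcol mxcolK submxcolB.
rewrite submxcolZ submxcol_strict_upper_gram block_row_mulmx.
have -> : \sum_(l < n | (i < l)%N) A l *m submxcol (x k.+1 - x k) l
    = \sum_(l < n | (i < l)%N) A l *m submxcol (x k.+1) l - S2.
  by rewrite /S2 -sumrB; apply: eq_bigr => l _; rewrite submxcolB mulmxBr.
(* The full new product is split into block [i], the blocks before it and the blocks after it, so
   that only the last group differs from the subproblem. *)
have -> : \sum_l A l *m submxcol (x k.+1) l = A i *m submxcol (x k.+1) i + S1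
    + \sum_(l < n | (i < l)%N) A l *m submxcol (x k.+1) l.
  rewrite (bigID (fun l : 'I_n => (l < i)%N)) /= addrC -/S1.
  rewrite (bigD1 i) ?ltnn//= -!addrA [S1 + _]addrC; congr (_ + (_ + _)).
  by apply: eq_bigl => l; rewrite -leqNgt ltn_neqAle andbC eq_sym.
rewrite !scalemxAr -mulmxDr opprD; congr (_ - _); rewrite -mulmxN; congr (_ *m _).
move: (A i *m _) (S1) (S2) (\sum_(l < n | _) _) => B T1 T2 T3.
by apply/colP => j; rewrite !mxE; field.
Qed.

End FadmmOptimality.

(** * One-step decrease of the Lyapunov function *)

Section Descent.
Context {R : realType} {d m : nat}.
Context (A : 'M[R]_(m, d)) (b : 'cV[R]_m) (T P : 'M[R]_d) (rho gamma mu S : R).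
Hypotheses (rho_gt0 : 0 < rho) (mu_gt0 : 0 < mu) (gamma_gt0 : 0 < gamma).
Hypothesis T_le : forall v, inner (T *m v) (T *m v) <= S ^+ 2 * inner v v.

(** The arguments are displacements from a reference point. The dual weight is chosen so that the
    cross term between multiplier and residual cancels in the descent estimate. *)
Definition lyapunov (x : 'cV[R]_d) (y : 'cV[R]_m) : R :=
  2^-1 * sqnormM P x + (2 * gamma * rho)^-1 * inner y y.

Lemma lyapunov_descent (x x' xs : 'cV[R]_d) (y y' ys : 'cV[R]_m) :
  P^T = P -> A *m xs = b -> y' = y - (gamma * rho) *: (A *m x' - b) ->
  mu * inner (x' - xs) (x' - xs) <=
    inner (A^T *m (y - rho *: (A *m x' - b)) + rho *: (T *m (x' - x))
           - P *m (x' - x) - A^T *m ys) (x' - xs) ->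
  rho * (1 - gamma / 2) * inner (A *m x' - b) (A *m x' - b)
    + 2^-1 * sqnormM (P - (rho ^+ 2 / (2 * mu) * S ^+ 2)%:M) (x' - x)
    + lyapunov (x' - xs) (y' - ys) <= lyapunov (x - xs) (y - ys).
Proof.
move=> Psym <- ->.
have -> : y - (gamma * rho) *: (A *m x' - A *m xs) - ys =
    (y - ys) - (gamma * rho) *: (A *m x' - A *m xs) by rewrite addrAC.
rewrite -!mulmxBr.
have -> : A^T *m (y - rho *: (A *m (x' - xs))) + rho *: (T *m (x' - x))
     - P *m (x' - x) - A^T *m ys
   = A^T *m ((y - ys) - rho *: (A *m (x' - xs))) + rho *: (T *m (x' - x))
     - P *m (x' - x).
  rewrite (mulmxBr _ (y - ys)) (mulmxBr _ y ys) (mulmxBr _ y).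
  move: (A^T *m y) (A^T *m ys) (A^T *m (rho *: _)) (rho *: (T *m _)) (P *m _) => *.
  by apply/colP => j; rewrite !mxE; ring.
have -> : x' - x = (x' - xs) - (x - xs) by rewrite opprB addrA subrK.
(* Since [b = A *m xs], only displacements remain: [e] new primal, [e0] old primal, [v] old dual.
   Below, [w] is [T (e - e0)] and [r] is the residual [A e]. *)
move: (x' - xs) (x - xs) (y - ys) => e e0 v.
rewrite /lyapunov !sqnormME mulmxBl mul_scalar_mx.
have := T_le (e - e0).
(* This square, divided by [4 * mu], is Young's inequality with exactly the weight [mu] that strong
   monotonicity can absorb. *)
have := inner_ge0 ((2 * mu) *: e - rho *: (T *m (e - e0))).
move: (T *m (e - e0)) => w.
rewrite !innerDZ (inner_mulmxl A^T) trmxK.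
move: (A *m e) => r.
rewrite !mulmxBr !innerDZ (innerC w e) (innerC r v) (innerC (P *m e)).
rewrite (innerC (P *m e0)) (inner_sym e0 e Psym) (innerC e0 e).
move=> young Tle mono; set K := rho ^+ 2 / (4 * mu).
have K_ge0 : 0 <= K by rewrite divr_ge0 ?sqr_ge0// mulr_ge0// ltW.
have {young} : rho * inner e w <= mu * inner e e + K * inner w w.
  rewrite -(ler_pM2l (_ : 0 < 4 * mu)) ?mulr_gt0//.
  rewrite mulrDr [X in _ + X](_ : _ = rho ^+ 2 * inner w w); last first.
    by rewrite /K; field; rewrite gt_eqF.
  by lra.
have := ler_wpM2l K_ge0 Tle.
have -> : rho ^+ 2 / (2 * mu) = 2 * K by rewrite /K; field; rewrite gt_eqF.
(* Expansion of the new dual term: [- inner v r] cancels the coupling term of the monotonicity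
   inequality, and [gamma * rho / 2] turns [rho] into [rho * (1 - gamma / 2)]. *)
rewrite [X in _ + (_ + X) <= _](_ : _ = (2 * gamma * rho)^-1 * inner v v
    - inner v r + gamma * rho / 2 * inner r r); last first.
  by field; rewrite !gt_eqF.
lra.
Qed.

Lemma lyapunov_ge0 x y : posdef P -> 0 <= lyapunov x y.
Proof.
move=> pP; rewrite addr_ge0// mulr_ge0 ?invr_ge0 ?sqnormM_ge0 ?inner_ge0//.
by rewrite !mulr_ge0// ltW.
Qed.

Lemma sqnormM_le_lyapunov x y : sqnormM P x <= 2 * lyapunov x y.
Proof.
rewrite /lyapunov mulrDr mulrA divff// mul1r lerDl.
by rewrite !mulr_ge0 ?invr_ge0 ?inner_ge0// !mulr_ge0// ltW.
Qed.

Lemma inner_le_lyapunov x y : posdef P ->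
  inner y y <= 2 * gamma * rho * lyapunov x y.
Proof.
move=> pP; rewrite /lyapunov mulrDr mulrA mulrA divff ?mul1r ?lerDr; last first.
  by rewrite !mulf_neq0// gt_eqF.
by rewrite !mulr_ge0 ?invr_ge0 ?sqnormM_ge0// ltW.
Qed.

End Descent.

(** * Convergence of an abstract splitting scheme satisfying the optimality relation *)

Section Convergence.
Context {R : realType} {d m : nat}.
Context (F : 'cV[R]_d -> \bar R) (A : 'M[R]_(m, d)) (b : 'cV[R]_m).
Context (T P : 'M[R]_d) (rho gamma mu S : R).
Context (x : nat -> 'cV[R]_d) (y : nat -> 'cV[R]_m).
Hypotheses (rho_gt0 : 0 < rho) (mu_gt0 : 0 < mu) (gamma02 : 0 < gamma < 2).
Hypothesis T_le : forall v, inner (T *m v) (T *m v) <= S ^+ 2 * inner v v.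
Hypothesis Psym : P^T = P.
Hypothesis posdefP : posdef (P - (rho ^+ 2 / (2 * mu) * S ^+ 2)%:M).
Hypothesis monoF : forall z w s t, subdiff F z s -> subdiff F w t ->
  mu * inner (z - w) (z - w) <= inner (s - t) (z - w).
(** Stated for arbitrary proper filters because the limit is taken along an ultrafilter. *)
Hypothesis closedF : forall (U : set_system nat) (UF : ProperFilter U)
    (u v : nat -> 'cV[R]_d) z s, (forall k, subdiff F (u k) (v k)) ->
  u @ U --> (z : 'cV_d) -> v @ U --> (s : 'cV_d) -> subdiff F z s.
Hypothesis subdiffx : forall k, subdiff F (x k.+1)
  (A^T *m (y k - rho *: (A *m x k.+1 - b)) + rho *: (T *m (x k.+1 - x k))
   - P *m (x k.+1 - x k)).
Hypothesis yE : forall k, y k.+1 = y k - (gamma * rho) *: (A *m x k.+1 - b).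

Let V (u : 'cV[R]_d * 'cV[R]_m) k :=
  lyapunov P rho gamma (x k - u.1) (y k - u.2).
Let Q := P - (rho ^+ 2 / (2 * mu) * S ^+ 2)%:M.
Let r k := A *m x k.+1 - b.

Let posP : posdef P.
Proof.
apply: posdefD_scalar posdefP _.
by rewrite mulr_ge0 ?sqr_ge0// divr_ge0 ?sqr_ge0// mulr_ge0 ?ltW.
Qed.

Let V_ge0 u k : 0 <= V u k.
Proof. by apply: lyapunov_ge0 => //; case/andP: gamma02. Qed.

Let V_descent u k : kkt_points F A b u ->
  rho * (1 - gamma / 2) * inner (r k) (r k)
    + 2^-1 * sqnormM Q (x k.+1 - x k) + V u k.+1 <= V u k.
Proof.
move=> [us uA]; have /andP[gamma0 _] := gamma02.
by apply: lyapunov_descent => //; exact: monoF.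
Qed.

Let rr_coef : 0 < rho * (1 - gamma / 2).
Proof.
by case/andP: gamma02 => _ g2; rewrite mulr_gt0// subr_gt0 ltr_pdivrMr// mul1r.
Qed.

Let res_ge0 k : 0 <= 2^-1 * sqnormM Q (x k.+1 - x k).
Proof. by rewrite mulr_ge0 ?sqnormM_ge0. Qed.

Let rr_ge0 k : 0 <= rho * (1 - gamma / 2) * inner (r k) (r k).
Proof. by rewrite mulr_ge0 ?inner_ge0// ltW. Qed.

Let V_noninc u : kkt_points F A b u -> {homo V u : i j / (i <= j)%N >-> j <= i}.
Proof.
move=> hu; apply/nonincreasing_seqP => k.
by have := V_descent k hu; have := res_ge0 k; have := rr_ge0 k; lra.
Qed.

Let V_cvg u : kkt_points F A b u -> exists l : R, V u @ \oo --> l.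
Proof.
move=> hu; exists (lim (V u @ \oo)); apply: nonincreasing_is_cvgn (V_noninc hu) _.
by exists 0 => _ [k _ <-]; exact: V_ge0.
Qed.

(** The decrements of the convergent sequence [V u] tend to 0 and dominate [a * g]. *)
Let residual_cvg0 (a : R) (g : nat -> R) : 0 < a ->
  (exists u, kkt_points F A b u) -> (forall k, 0 <= g k) ->
  (forall u k, kkt_points F A b u -> a * g k <= V u k - V u k.+1) ->
  g @ \oo --> (0 : R).
Proof.
move=> a0 [u hu] g_ge0 gV; have [l Vl] := V_cvg hu.
have VS : (fun k => V u k.+1) @ \oo --> l by rewrite (cvg_shiftS (V u)).
have dV : (fun k => a^-1 * (V u k - V u k.+1)) @ \oo --> (0 : R).
  rewrite -[X in _ --> X](mulr0 a^-1); apply: cvg_mulrl.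
  by rewrite -(subrr l); exact: cvgB.
apply: (squeeze_cvgr _ (cvg_cst 0) dV); apply: nearW => k.
by rewrite g_ge0 /= ler_pdivlMl// gV.
Qed.

Lemma splitting_cvg : (exists u, kkt_points F A b u) ->
  exists2 u, kkt_points F A b u & (fun k => (x k, y k)) @ \oo --> u.
Proof.
move=> kkt; have /andP[gamma_gt0 _] := gamma02.
have r0 : r @ \oo --> (0 : 'cV_m).
  apply: (cvg_sqnormM0 (posdef_1 m)).
  under eq_fun do rewrite sqnormME mul1mx.
  apply: (residual_cvg0 rr_coef kkt) => [k|u k hu]; first exact: inner_ge0.
  by have := V_descent k hu; have := res_ge0 k; lra.
have d0 : (fun k => x k.+1 - x k) @ \oo --> (0 : 'cV_d).
  apply: (cvg_sqnormM0 posdefP).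
  apply: (residual_cvg0 (a := 2^-1) _ kkt) => [||u k hu]; first by rewrite invr_gt0.
    by move=> k; exact: sqnormM_ge0.
  by have := V_descent k hu; have := rr_ge0 k; rewrite /Q; lra.
have [us hus] := kkt.
have Vle k : V us k <= V us 0 by exact: V_noninc.
(* An ultrafilter finer than the eventual filter plays the part of a convergent subsequence; by
   [leU], limits at infinity are also limits along [U]. *)
have [U [UU leU]] := ultraFilterLemma (@eventually_filter).
have UF : ProperFilter U by exact: ultra_proper.
have [dx dxU] : exists l : 'cV[R]_d, (fun k => x k - us.1) @ U --> l.
  apply: (ultra_bounded_cvg_mx (C := 2 * V us 0) posP) => k.
  apply: le_trans (sqnormM_le_lyapunov P rho_gt0 gamma_gt0 _ (y k - us.2)) _.
  by rewrite ler_wpM2l//; exact: Vle.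
have [dy dyU] : exists l : 'cV[R]_m, (fun k => y k - us.2) @ U --> l.
  apply: (ultra_bounded_cvg_mx (C := 2 * gamma * rho * V us 0) (posdef_1 m)) => k.
  rewrite sqnormME mul1mx.
  apply: le_trans (inner_le_lyapunov rho_gt0 gamma_gt0 (x k - us.1) _ posP) _.
  by apply: ler_wpM2l; [rewrite !mulr_ge0 ?ltW | exact: Vle].
have [xL xU] : exists l : 'cV[R]_d, x @ U --> l.
  exists (dx + us.1); rewrite [x](_ : _ = fun k => x k - us.1 + us.1).
    by apply: cvgD => //; exact: cvg_cst.
  by apply/funext => k; rewrite subrK.
have [yL yU] : exists l : 'cV[R]_m, y @ U --> l.
  exists (dy + us.2); rewrite [y](_ : _ = fun k => y k - us.2 + us.2).
    by apply: cvgD => //; exact: cvg_cst.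
  by apply/funext => k; rewrite subrK.
have dU : (fun k => x k.+1 - x k) @ U --> (0 : 'cV_d).
  by move=> B /d0; exact: leU.
have rU : r @ U --> (0 : 'cV_m) by move=> B /r0; exact: leU.
(* The subgradient relation lives at [x k.+1], and convergence along [U] need not survive an index
   shift; the vanishing increments bridge the gap. *)
have xSU : (fun k => x k.+1) @ U --> xL.
  rewrite [X in X @ _](_ : _ = fun k => x k + (x k.+1 - x k)); last first.
    by apply/funext => k; rewrite addrC subrK.
  by rewrite -[xL]addr0; exact: cvgD.
(* As residuals and increments vanish, the subgradients tend to [A^T *m yL] along [U]. *)
have hL : kkt_points F A b (xL, yL).
  split=> /=.
    apply: (closedF UF subdiffx xSU).
    rewrite -[X in _ --> X]subr0 -(mulmx0 _ P).
    apply: cvgB; last exact: cvg_mulmx.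
    rewrite -[X in _ --> X]addr0 -[X in _ --> _ + X](scaler0 _ rho) -(mulmx0 _ T).
    apply: cvgD; last by apply: cvgZr; exact: cvg_mulmx.
    apply: cvg_mulmx.
    have : (fun k => y k - rho *: r k) @ U --> yL - rho *: (0 : 'cV_m).
      by apply: (cvgB yU); exact: cvgZr.
    by rewrite scaler0 subr0.
  apply/eqP; rewrite -subr_eq0; apply/eqP.
  have rL : r @ U --> A *m xL - b.
    by apply: cvgB; [exact: cvg_mulmx | exact: cvg_cst].
  exact: (norm_cvg_unique rL rU).
(* The Lyapunov function is now centred at the limit point: being KKT, that point makes [V] converge
   along the whole sequence, and its limit can be read off along [U]. *)
have [l Vl] := V_cvg hL.
have VU : V (xL, yL) @ U --> (0 : R).
  have xx : (fun k => x k - xL) @ U --> (0 : 'cV_d).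
    exact/subr_cvg0.
  have yy : (fun k => y k - yL) @ U --> (0 : 'cV_m).
    exact/subr_cvg0.
  have -> : 0 = 2^-1 * inner 0 (P *m (0 : 'cV[R]_d))
      + (2 * gamma * rho)^-1 * inner (0 : 'cV[R]_m) 0 :> R.
    by rewrite /inner !mulmx0 !mxE !mulr0 addr0.
  rewrite /V /lyapunov; under eq_fun do rewrite sqnormME /=.
  apply: cvgD; apply: cvg_mulrl; last exact: (cvg_inner yy yy).
  by apply: (cvg_inner xx); exact: cvg_mulmx.
have l0 : l = 0.
  have VlU : V (xL, yL) @ U --> l by move=> B /Vl /leU.
  exact: (norm_cvg_unique VlU VU).
rewrite {}l0 in Vl.
have cV c : (fun k => c * V (xL, yL) k) @ \oo --> (0 : R).
  have := @cvg_mulrl _ _ _ eventually_filter c _ _ Vl; by rewrite mulr0.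
have xoo : x @ \oo --> xL.
  apply/subr_cvg0; apply: (cvg_sqnormM0 posP).
  apply: (squeeze_cvgr _ (cvg_cst 0) (cV 2)); apply: nearW => k.
  by rewrite sqnormM_ge0//= sqnormM_le_lyapunov.
have yoo : y @ \oo --> yL.
  apply/subr_cvg0; apply: (cvg_sqnormM0 (posdef_1 m)).
  under eq_fun do rewrite sqnormME mul1mx.
  apply: (squeeze_cvgr _ (cvg_cst 0) (cV (2 * gamma * rho))); apply: nearW => k.
  by rewrite inner_ge0//= inner_le_lyapunov.
by exists (xL, yL) => //; exact: (cvg_pair xoo yoo).
Qed.

End Convergence.

(** * KKT points give primal and dual solutions *)

Section SaddlePoint.
Context {R : realType} {d m : nat}.
Context (F : 'cV[R]_d -> \bar R) (A : 'M[R]_(m, d)) (b : 'cV[R]_m).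
Hypothesis FNy : forall x, F x != -oo%E.

(** Moving [A^T] across the inner product turns the subgradient inequality into minimality of [u.1]
    for the Lagrangian with multiplier [u.2]. *)
Lemma kkt_lagrangian_le u w : kkt_points F A b u ->
  (F u.1 <= F w - (inner u.2 (A *m w - b))%:E)%E.
Proof.
move=> [[Fu us] uA]; have [a aE] := edomP (FNy _) Fu.
have [Fw|] := boolP (F w < +oo)%E; last first.
  by rewrite -leNgt leye_eq => /eqP ->; rewrite leey.
have [c cE] := edomP (FNy _) Fw; have := us w Fw.
rewrite aE cE inner_mulmxl trmxK mulmxBr uA !lee_fin; lra.
Qed.

Lemma kkt_primal_solution u :
  kkt_points F A b u -> primal_solution F A b u.1.
Proof.
move=> hu; have [[Fu _] uA] := hu; split=> // w wA.
have := kkt_lagrangian_le w hu.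
by rewrite wA subrr /inner mulmx0 mxE sube0.
Qed.

(** [F u.1] separates the two dual values: weak duality at the feasible [u.1] bounds that of [y']
    from above, Lagrangian minimality bounds that of [u.2] from below. *)
Lemma kkt_dual_solution u : kkt_points F A b u -> dual_solution F A b u.2.
Proof.
move=> hu y'; have [_ uA] := hu; apply: (@le_trans _ _ (F u.1)).
  apply: ereal_inf_lbound; exists u.1 => //.
  by rewrite uA subrr /inner mulmx0 mxE sube0.
by apply: le_ereal_inf_tmp => _ [w _ <-]; exact: kkt_lagrangian_le.
Qed.

End SaddlePoint.

(** * F-ADMM as an instance of the abstract splitting scheme *)

Unset Implicit Arguments.
Set Strict Implicit.

Theorem theorem8 (R : realType) (n m : nat) (hn : (2 <= n)%N)
  (N : 'I_n -> nat)
  (f : forall i : 'I_n, 'cV[R]_(N i) -> \bar R)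
  (A : forall i : 'I_n, 'M[R]_(m, N i)) (b : 'cV[R]_m)
  (P : forall i : 'I_n, 'M[R]_(N i))
  (mu_ : 'I_n -> R) (mu rho gamma : R)
  (x : nat -> 'cV[R]_(\sum_i N i)) (y : nat -> 'cV[R]_m)
  (hf : forall i, closed_convex (f i))
  (hKKT : kkt_points (separable_sum f) (block_row A) b !=set0)
  (hmu_ : forall i, strongly_convex (f i) (mu_ i))
  (hmu : is_minimum mu_ mu)
  (hPsym : forall i, (P i)^T = P i)
  (hP : forall i, posdef
     (P i - (rho ^+ 2 / (2 * mu) * spectral_norm (strict_upper_gram A) ^+ 2)%:M))
  (hrho : 0 < rho) (hgamma : 0 < gamma < 2)
  (hxy : fadmm_sequence f A b P rho gamma x y) :
  exists u : 'cV[R]_(\sum_i N i) * 'cV[R]_m,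
    [/\ kkt_points (separable_sum f) (block_row A) b u,
        (fun k => (x k, y k)) @ \oo --> u,
        primal_solution (separable_sum f) (block_row A) b u.1 &
        dual_solution (separable_sum f) (block_row A) b u.2].
Proof.
have fNy i z : f i z != -oo%E by have [] := hf i.
have FNy := separable_sumNy fNy.
have [[i0 mu_i0] mu_min] := hmu.
have mu_gt0 : 0 < mu by rewrite mu_i0; have [] := hmu_ i0.
(* A KKT point has finite objective, hence a finite value in each block. *)
have fdom i : exists w, edom (f i) w.
  have [u [[/(edom_separable fNy) fu _] _]] := hKKT.
  by exists (submxcol u.1 i).
have Psym : (\mxdiag_i P i)^T = \mxdiag_i P i.
  by rewrite tr_mxdiag; apply: eq_mxdiag.
have [u hu xyu] := splitting_cvg hrho mu_gt0 hgamma
  (@inner_spectral_norm R _ _ (strict_upper_gram A)) Psym (posdef_mxdiag hP)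
  (fun z w s t => separable_monotone fNy mu_min hmu_)
  (fun U UF u v z s => separable_subdiff_closed UF hf)
  (fun k => fadmm_subdiff k hf fdom hPsym (lt0r_neq0 hrho) hxy)
  (fun k => (hxy k).2) hKKT.
exists u; split=> //; first exact: kkt_primal_solution.
exact: kkt_dual_solution.
Qed.
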